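(* Let $R_1,\ldots,R_N$ be given $n\times n$ Toeplitz positive definite Hermitian matrices, let $\theta=(\theta^1,\ldots,\theta^m)$ be coordinates on the manifold $Sym(n,\mathbb{C})$ of all $n\times n$ Toeplitz positive definite Hermitian matrices, write $R=R(\theta)$ for the matrix with coordinates $\theta$, and let $$L(\theta)=\frac1N\sum_{i=1}^N d^2(R_i,R(\theta)).$$ The natural gradient descent iteration for $L$ on $Sym(n,\mathbb{C})$, with learning rate $\eta$, is given by $$\theta_{k+1}=\theta_k-\eta\,G^{-1}\nabla|_{\theta=\theta_k}L(\theta),$$ where $G$ is the matrix of the Riemannian metric in the coordinates $\theta$ at $\theta_k$, $$\nabla L(\theta)=\left(\frac{\partial}{\partial\theta^1}L(\theta),\frac{\partial}{\partial\theta^2}L(\theta),\ldots,\frac{\partial}{\partial\theta^m}L(\theta)\right),$$ and the components of $\nabla L(\theta)$ satisfy $$\frac{\partial}{\partial\theta^j}L(\theta)=\frac2N\operatorname{tr}\left(\sum_{i=1}^N R_i^{-\frac12}\ln\left(R_i^{-\frac12}RR_i^{-\frac12}\right)R_i^{\frac12}R^{-1}\frac{\partial}{\partial\theta^j}R\right),\qquad j=1,2,\ldots,m.$$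
   Context: $P(n)$ is the manifold of $n\times n$ positive definite Hermitian complex matrices, with Riemannian metric $g_A(X,Y)=\operatorname{tr}(A^{-1}XA^{-1}Y)$ for Hermitian $X,Y$, and geodesic distance $d(A,B)=\|\ln(A^{-1/2}BA^{-1/2})\|_F$, where $\|\cdot\|_F$ is the Frobenius norm and $\ln$ is the Hermitian logarithm of a positive definite Hermitian matrix. $Sym(n,\mathbb{C})\subset P(n)$ is the submanifold of Toeplitz positive definite Hermitian matrices, equipped with the induced metric; in smooth coordinates $\theta$ its metric matrix is $G=(g_{ij})$ with $g_{ij}(\theta)=\operatorname{tr}\left(R^{-1}\frac{\partial R}{\partial\theta^i}R^{-1}\frac{\partial R}{\partial\theta^j}\right)$, where $R=R(\theta)$. The natural gradient descent iteration for a cost function $L(\theta)$ on a Riemannian manifold with coordinates $\theta\in\mathbb{R}^m$ and metric matrix $G(\theta)$ is the update of the coordinates by $-\eta$ times the Riemannian gradient $G^{-1}\nabla L$ of $L$ at $\theta_k$, where $\nabla L$ is the vector of ordinary partial derivatives of $L$. *)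

(* Defs.v *)
From HB Require Import structures.
From mathcomp Require Import all_boot all_order all_algebra.
From mathcomp Require Import sesquilinear spectral.
From mathcomp Require Import all_classical all_reals all_analysis.
From mathcomp Require Import complex.

Set Implicit Arguments.
Unset Strict Implicit.
Unset Printing Implicit Defensive.

Import Order.TTheory GRing.Theory Num.Theory.
Import numFieldNormedType.Exports.

Local Open Scope classical_set_scope.
Local Open Scope complex_scope.
Local Open Scope sesquilinear_scope.
Local Open Scope ring_scope.

Section Matrices.
Context {R : realType} {n : nat}.
Implicit Types A B X Y : 'M[R[i]]_n.

(* The order of R[i] makes 0 < z entail that z is real. *)
Definition posdefmx A : Prop :=
  A \is hermsymmx /\
  forall x : 'rV[R[i]]_n, x != 0 -> 0 < (x *m A *m x ^t*) 0 0.

(* A a b depends only on a - b; this is a - b = c - d without truncation. *)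
Definition toeplitzmx A : Prop :=
  forall a b c d : 'I_n, (a + d = c + b)%N -> A a b = A c d.

(* Sym(n, C) *)
Definition toeplitz_posdef : set 'M[R[i]]_n :=
  [set A | posdefmx A /\ toeplitzmx A].

(* Functional calculus f(A) of a Hermitian matrix A, whose spectral_diag is
   real. *)
Definition hermfun (f : R -> R) A : 'M[R[i]]_n :=
  invmx (spectralmx A)
  *m diag_mx (map_mx (fun z : R[i] => (f (complex.Re z))%:C) (spectral_diag A))
  *m spectralmx A.

Definition lnmx A := hermfun (@ln R) A.
Definition sqrtmx A := hermfun (@Num.sqrt R) A.
Definition invsqrtmx A := hermfun (fun x => (Num.sqrt x)^-1) A.

Definition frobenius A : R :=
  Num.sqrt (\sum_a \sum_b (complex.Re (A a b) ^+ 2 + complex.Im (A a b) ^+ 2)).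

Definition geodist A B : R :=
  frobenius (lnmx (invsqrtmx A *m B *m invsqrtmx A)).

(* The trace is real when A, X and Y are Hermitian, see riem_metricE. *)
Definition riem_metric A X Y : R :=
  complex.Re (\tr (invmx A *m X *m invmx A *m Y)).

Lemma riem_metricE A X Y :
  A \is hermsymmx -> X \is hermsymmx -> Y \is hermsymmx ->
  (riem_metric A X Y)%:C = \tr (invmx A *m X *m invmx A *m Y).
Proof.
move=> /is_hermitianmxP hA /is_hermitianmxP hX /is_hermitianmxP hY.
rewrite !expr0 !scale1r in hA hX hY.
have hV : invmx A ^t* = invmx A by rewrite trmx_inv map_invmx -hA.
set M := _ *m Y.
have hM : (\tr M)^* = \tr M.
  rewrite -[in LHS]mxtrace_tr -trace_map_mx /M !trmx_mul !map_mxM hV -hX -hY.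
  by rewrite mxtrace_mulC !mulmxA.
by rewrite /riem_metric -/M RRe_real // CrealE; apply/eqP.
Qed.

End Matrices.

Section Coordinates.
Context {R : realType} {m : nat}.
Implicit Types (t v w : 'cV[R]_m) (U : set 'cV[R]_m).

Fixpoint Ck (k : nat) U (f : 'cV[R]_m -> R) : Prop :=
  match k with
  | 0 => forall t, U t -> {for t, continuous f}
  | k'.+1 => (forall t, U t -> differentiable f t) /\
             forall j : 'I_m, Ck k' U (fun t => 'D_(delta_mx j 0) f t)
  end.

Definition smooth U f : Prop := forall k, Ck k U f.

Context {n : nat}.
Implicit Types P : 'cV[R]_m -> 'M[R[i]]_n.

Definition dirmx P t v : 'M[R[i]]_n :=
  \matrix_(a, b) ('D_v (fun s => complex.Re (P s a b)) t
                  +i* 'D_v (fun s => complex.Im (P s a b)) t).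

Definition partialmx P (j : 'I_m) t : 'M[R[i]]_n := dirmx P t (delta_mx j 0).

(* P is the inverse of a (local or global) coordinate chart of the embedded
   submanifold Sym(n, C), with coordinate domain U: a smooth injective
   immersion of the open set U which is open as a map into Sym(n, C), hence a
   homeomorphism onto a relatively open subset of it. *)
Record coordinates U P : Prop := Coordinates {
  coord_open : open U;
  coord_mem : forall t, U t -> toeplitz_posdef (P t);
  coord_smooth : forall a b, smooth U (fun t => complex.Re (P t a b)) /\
                             smooth U (fun t => complex.Im (P t a b));
  coord_inj : forall t t', U t -> U t' -> P t = P t' -> t = t';
  coord_immersion : forall t v, U t -> dirmx P t v = 0 -> v = 0;
  coord_open_map : forall t (W : set 'cV[R]_m), U t -> nbhs t W ->
    exists2 e : R, 0 < e & forall A, toeplitz_posdef A ->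
      frobenius (A - P t) < e -> exists2 t', (U `&` W) t' & P t' = A
}.

Definition metric_matrix P t : 'M[R]_m :=
  \matrix_(i, j) riem_metric (P t) (partialmx P i t) (partialmx P j t).

Definition nabla (L : 'cV[R]_m -> R) t : 'cV[R]_m :=
  \col_j 'D_(delta_mx j 0) L t.

(* v is the coordinate vector of the Riemannian gradient of L at t: the tangent
   vector dual to the differential of L under the metric induced via P. *)
Definition is_riem_grad P (L : 'cV[R]_m -> R) t v : Prop :=
  differentiable L t /\
  forall w, 'd L t w = riem_metric (P t) (dirmx P t v) (dirmx P t w).

Definition natural_gradient_step P (L : 'cV[R]_m -> R) (eta : R) t t' : Prop :=
  exists2 v, is_riem_grad P L t v & t' = t - eta *: v.

Definition cost N (Rs : 'I_N -> 'M[R[i]]_n) P t : R :=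
  N%:R^-1 * \sum_(i < N) geodist (Rs i) (P t) ^+ 2.

End Coordinates.

(* Main.v *)
(* For Hermitian A and B with orthonormal eigenbases (u_i), (v_j) and
   eigenvalues a_i, b_j, tr (f(A) g(B)) is the sum of
   |<u_i, v_j>|^2 f(a_i) g(b_j). Hence tr f(B) - tr f(A) - tr (f'(A)(B - A))
   is the sum of |<u_i, v_j>|^2 (f(b_j) - f(a_i) - f'(a_i)(b_j - a_i)), and the
   same weights give |B - A|_F^2 as the sum of |<u_i, v_j>|^2 (b_j - a_i)^2.
   A scalar Taylor bound for f = ln^2 thus yields a quadratic remainder for
   tr ln^2, i.e. its Frechet differential X |-> 2 tr (ln(A) A^-1 X), without any
   perturbation theory of eigenvalues. Composing with
   B(t) = R_i^(-1/2) R(t) R_i^(-1/2) gives the gradient of L. The metric matrix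
   is invertible because tr (A^-1 X A^-1 X) = |A^(-1/2) X A^(-1/2)|_F^2 and R is
   an immersion. *)

Require Import Defs.
From HB Require Import structures.
From mathcomp Require Import all_boot all_order all_algebra.
From mathcomp Require Import sesquilinear spectral.
From mathcomp Require Import all_classical all_reals all_analysis.
From mathcomp Require Import complex.
From mathcomp Require Import ring lra.

Set Implicit Arguments.
Unset Strict Implicit.
Unset Printing Implicit Defensive.

Import Order.TTheory GRing.Theory Num.Theory.
Import numFieldNormedType.Exports.

Local Open Scope classical_set_scope.
Local Open Scope complex_scope.
Local Open Scope sesquilinear_scope.
Local Open Scope ring_scope.

(** * Functional calculus and traces of Hermitian matrices *)

Section HermitianCalculus.
Context {R : realType} {n : nat}.
Implicit Types (A B H X Y : 'M[R[i]]_n) (f g : R -> R).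

(** For Hermitian [A] the spectral diagonal is real, so taking real parts loses nothing and the
    eigenvalues can be fed to real functions. *)
Definition eigv A (k : 'I_n) : R := complex.Re (spectral_diag A 0 k).

Lemma hermsymmxP A : A \is hermsymmx <-> A ^t* = A.
Proof.
split=> [/is_hermitianmxP|hA]; first by rewrite expr0 scale1r => <-.
by apply/is_hermitianmxP; rewrite expr0 scale1r hA.
Qed.

Lemma conj_real_complex (x : R) : (x%:C)^* = x%:C :> R[i].
Proof. by apply/eqP; rewrite -CrealE complex_real. Qed.

Lemma hermfunE f A : hermfun f A =
  (spectralmx A)^t* *m diag_mx (\row_k (f (eigv A k))%:C) *m spectralmx A.
Proof.
rewrite /hermfun (invmx_unitary (spectral_unitarymx A)).
have -> // : map_mx (fun z => (f (complex.Re z))%:C) (spectral_diag A) =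
  \row_k (f (eigv A k))%:C by apply/rowP => k; rewrite !mxE.
Qed.

Lemma spectralmxKV A : (spectralmx A)^t* *m spectralmx A = 1%:M.
Proof.
by rewrite -(invmx_unitary (spectral_unitarymx A)) mulVmx // spectral_unit.
Qed.

Lemma spectralmxK A : spectralmx A *m (spectralmx A)^t* = 1%:M.
Proof. exact/unitarymxP/spectral_unitarymx. Qed.

Lemma diag_real_herm (d : 'I_n -> R) :
  (diag_mx (\row_k (d k)%:C) : 'M[R[i]]_n)^t* = diag_mx (\row_k (d k)%:C).
Proof.
rewrite tr_diag_mx map_diag_mx; congr diag_mx.
by apply/rowP => k; rewrite !mxE /= conj_real_complex.
Qed.

Lemma diag_realM (d e : 'I_n -> R) :
  diag_mx (\row_k (d k)%:C) *m diag_mx (\row_k (e k)%:C) =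
  diag_mx (\row_k (d k * e k)%:C) :> 'M[R[i]]_n.
Proof.
by rewrite mulmx_diag; congr diag_mx; apply/rowP => k; rewrite !mxE rmorphM.
Qed.

Lemma hermfun_hermitian f A : (hermfun f A)^t* = hermfun f A.
Proof.
rewrite hermfunE; move: (spectralmx A) => V.
by rewrite !trmx_mul !map_mxM diag_real_herm trmxCK mulmxA.
Qed.

(** Only values at eigenvalues enter, so scalar identities valid for positive reals transfer to
    positive definite matrices. *)
Lemma eq_hermfun f g A :
  (forall k, f (eigv A k) = g (eigv A k)) -> hermfun f A = hermfun g A.
Proof.
move=> fg; rewrite !hermfunE.
by have -> : \row_k (f (eigv A k))%:C = \row_k (g (eigv A k))%:C
  by apply/rowP => k; rewrite !mxE fg.
Qed.

Lemma hermfunM f g A :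
  hermfun f A *m hermfun g A = hermfun (fun x => f x * g x) A.
Proof.
rewrite !hermfunE; move: (spectralmx A) (spectralmxK A) => V VK.
rewrite -(diag_realM (fun k => f (eigv A k)) (fun k => g (eigv A k))).
move: (diag_mx _) (diag_mx _) => D E.
by rewrite !mulmxA -(mulmxA _ V) VK mulmx1.
Qed.

Lemma hermfun1 A : hermfun (fun=> 1) A = 1%:M.
Proof.
have one : \row_(k < n) (1 : R)%:C = const_mx 1.
  by apply/rowP => k; rewrite !mxE.
rewrite hermfunE one.
by rewrite diag_const_mx mulmx1 spectralmxKV.
Qed.

(** This is the spectral theorem: a Hermitian matrix is normal and its eigenvalues are real. *)
Lemma hermfun_id A : A^t* = A -> hermfun id A = A.
Proof.
move=> /hermsymmxP hA; rewrite hermfunE.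
have -> : \row_k (id (eigv A k))%:C = spectral_diag A.
  apply/rowP => k; rewrite mxE RRe_real //.
  by move/mxOverP: (hermitian_spectral_diag_real hA); apply.
rewrite -(invmx_unitary (spectral_unitarymx A)); apply/esym.
exact: (orthomx_spectralP (hermitian_normalmx hA)).
Qed.

(* The weights |<u_i, v_j>|^2 of two spectral decompositions. *)
Definition overlap A B (i j : 'I_n) : R :=
  complex.Re (`|(spectralmx A *m (spectralmx B)^t*) i j| ^+ 2).

Lemma overlap_ge0 A B i j : 0 <= overlap A B i j.
Proof.
rewrite /overlap; move: (_ i j) => z.
have : (0 : R[i]) <= `|z| ^+ 2 by rewrite exprn_ge0.
by rewrite lecE => /andP[].
Qed.

Lemma overlapE A B i j (W := spectralmx A *m (spectralmx B)^t*) :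
  (overlap A B i j)%:C = W i j * (W i j)^*.
Proof. by rewrite RRe_real -?normCK // rpredX // normr_real. Qed.

(** The change of eigenbasis W is a product of unitary matrices, so its columns have norm 1. *)
Lemma sum_overlap A B j : \sum_i overlap A B i j = 1.
Proof.
apply: (@complexI R); rewrite rmorph_sum /=.
under eq_bigr do rewrite overlapE.
set W := spectralmx A *m _.
have WW : W^t* *m W = 1%:M.
  rewrite /W trmx_mul map_mxM trmxCK mulmxA -[X in X *m _ = _]mulmxA.
  by rewrite spectralmxKV mulmx1 spectralmxK.
have := congr1 (fun M : 'M[R[i]]_n => M j j) WW.
rewrite !mxE eqxx mulr1n => W1; rewrite -[RHS]W1.
by apply: eq_bigr => i _; rewrite !mxE mulrC.
Qed.

Lemma trace_hermfunM f g A B : \tr (hermfun f A *m hermfun g B) =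
  (\sum_i \sum_j overlap A B i j * (f (eigv A i) * g (eigv B j)))%:C.
Proof.
rewrite !hermfunE -!mulmxA mxtrace_mulC.
set D := diag_mx _; set E := diag_mx _.
set W := spectralmx A *m (spectralmx B)^t*.
have -> : D *m (spectralmx A *m ((spectralmx B)^t* *m (E *m spectralmx B)))
    *m (spectralmx A)^t* = D *m (W *m E *m W^t*).
  by rewrite /W trmx_mul map_mxM trmxCK !mulmxA.
rewrite /mxtrace rmorph_sum; apply: eq_bigr => i _ /=.
rewrite mul_diag_mx !mxE rmorph_sum mulr_sumr; apply: eq_bigr => j _ /=.
rewrite mul_mx_diag !rmorphM /= overlapE !mxE.
rewrite -/W; ring.
Qed.

Definition frob2 X : R :=
  \sum_a \sum_b (complex.Re (X a b) ^+ 2 + complex.Im (X a b) ^+ 2).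

Lemma sqr_frobenius X : frobenius X ^+ 2 = frob2 X.
Proof.
rewrite /frobenius sqr_sqrtr // sumr_ge0 // => a _; rewrite sumr_ge0 // => b _.
by rewrite addr_ge0 // sqr_ge0.
Qed.

Lemma frob2_hermitian H : H^t* = H -> (frob2 H)%:C = \tr (H *m H).
Proof.
move=> hH; rewrite rmorph_sum; apply: eq_bigr => a _ /=.
rewrite rmorph_sum mxE; apply: eq_bigr => b _ /=.
have -> : H b a = (H a b)^* by rewrite -{1}hH !mxE.
by rewrite add_Re2_Im2 normCK.
Qed.

Lemma frob2_eq0 X : frob2 X = 0 -> X = 0.
Proof.
move=> /eqP; rewrite psumr_eq0 => [/allP X0|a _]; last first.
  by rewrite sumr_ge0 // => b _; rewrite addr_ge0 // sqr_ge0.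
apply/matrixP => a b; have := X0 a (mem_index_enum _).
rewrite psumr_eq0 => [/allP/(_ b (mem_index_enum _))|c _]; last first.
  by rewrite addr_ge0 // sqr_ge0.
rewrite paddr_eq0 ?sqr_ge0 // !sqrf_eq0 mxE => /andP[/eqP re0 /eqP im0].
by apply/eqP; rewrite eq_complex re0 im0 eqxx.
Qed.

(** The eigenvalue is the value of the quadratic form at row k of [spectralmx A], which is nonzero
    by unitarity. *)
Lemma eigv_gt0 A k : posdefmx A -> 0 < eigv A k.
Proof.
move=> [hA pA]; pose V := spectralmx A.
have : 0 < (row k V *m A *m (row k V)^t*) 0 0.
  apply: pA; apply/eqP => V0; have := spectral_unit A.
  have := spectralmxK A => /(congr1 (row k)); rewrite row_mul V0 mul0mx row1.
  by move=> /rowP/(_ k)/eqP; rewrite !mxE !eqxx eq_sym oner_eq0.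
have AE : V *m A *m V^t* = diag_mx (\row_k (eigv A k)%:C).
  rewrite -{1}(hermfun_id ((hermsymmxP A).1 hA)) hermfunE -/V.
  by rewrite !mulmxA spectralmxK mul1mx -mulmxA spectralmxK mulmx1.
have -> : (row k V *m A *m (row k V)^t*) 0 0 = (V *m A *m V^t*) k k.
  rewrite -row_mul mxE [RHS]mxE; apply: eq_bigr => l _.
  by rewrite !mxE.
by rewrite AE !mxE eqxx mulr1n ltcR.
Qed.

Lemma posdefmx_congr A H : posdefmx A -> H^t* = H -> H \in unitmx ->
  posdefmx (H *m A *m H).
Proof.
move=> [/hermsymmxP hA pA] hH Hu; split.
  by apply/hermsymmxP; rewrite !trmx_mul !map_mxM hA hH mulmxA.
move=> x x0; have /pA : x *m H != 0.
  apply: contraNneq x0 => /(congr1 (mulmxr (invmx H))).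
  by rewrite /= mulmxK // mul0mx => ->.
by rewrite trmx_mul map_mxM hH !mulmxA.
Qed.

Lemma hermfun_unit f A : (forall k, f (eigv A k) != 0) ->
  hermfun f A \in unitmx /\ invmx (hermfun f A) = hermfun (fun x => (f x)^-1) A.
Proof.
move=> f0; have e : hermfun f A *m hermfun (fun x => (f x)^-1) A = 1%:M.
  by rewrite hermfunM -(hermfun1 A); apply: eq_hermfun => k; rewrite divff.
have [fu _] := mulmx1_unit e; split => //.
by rewrite -[RHS]mul1mx -(mulVmx fu) -mulmxA e mulmx1.
Qed.

Lemma trace_herm_real X Y : X^t* = X -> Y^t* = Y ->
  (complex.Re (\tr (X *m Y)))%:C = \tr (X *m Y).
Proof.
move=> hX hY; rewrite RRe_real // CrealE; apply/eqP.
rewrite -[in LHS]mxtrace_tr -trace_map_mx trmx_mul map_mxM hX hY.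
by rewrite mxtrace_mulC.
Qed.

End HermitianCalculus.

(** * Scalar Taylor bounds and a criterion for differentiability *)

(** Everything follows from 1 - 1/s <= ln s <= s - 1, whose lower half is the upper half at 1/s. The
    two bounds differ by (s - 1)^2 / s, and 1/s <= 1/s0. *)
Lemma ln_taylor_le {R : realType} (s s0 : R) : 0 < s0 -> s0 <= s ->
  0 <= s - 1 - ln s <= (s - 1) ^+ 2 / s0 /\
  ln s ^+ 2 <= (s - 1) ^+ 2 * (1 + s0^-1 ^+ 2).
Proof.
move=> s0p s0s; have sp : 0 < s by exact: lt_le_trans s0s.
have up : ln s <= s - 1.
  by rewrite -[in ln s](subrKC 1 s) le_ln1Dx // ltrBDr addrC subrr.
have lo : 1 - s^-1 <= ln s.
  have := @le_ln1Dx R (s^-1 - 1).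
  rewrite ltrBDr addrC subrr invr_gt0 => /(_ sp).
  by rewrite subrKC lnV ?posrE // lerBrDr addrC => h; rewrite lerBlDr; lra.
have sv : 0 < s^-1 <= s0^-1 by rewrite invr_gt0 sp lef_pV2 ?posrE.
have ssv : s * s^-1 = 1 by rewrite divff // gt_eqF.
move: (ln s) up lo => r up lo.
have e1 : 1 - s^-1 = (s - 1) * s^-1 by rewrite mulrBl ssv mul1r.
have e2 : s - 1 - (1 - s^-1) = (s - 1) ^+ 2 * s^-1.
  by rewrite expr2 mulrBr mulr1 mulrBl -!mulrA mulrBl ssv; ring: ssv.
have b1 : (s - 1) ^+ 2 * s^-1 <= (s - 1) ^+ 2 * s0^-1.
  by rewrite ler_wpM2l ?sqr_ge0 //; case/andP: sv.
split; first by apply/andP; split; lra.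
have b2 : s^-1 ^+ 2 <= s0^-1 ^+ 2.
  by case/andP: sv => ? ?; rewrite ler_pXn2r ?nnegrE // ltW // invr_gt0.
have b3 : (s - 1) ^+ 2 * s^-1 ^+ 2 <= (s - 1) ^+ 2 * s0^-1 ^+ 2.
  by rewrite ler_wpM2l ?sqr_ge0.
(* As r lies between 1 - 1/s and s - 1, its square is at most one of their squares, according to its
   sign. *)
suff : r ^+ 2 <= (s - 1) ^+ 2 + (1 - s^-1) ^+ 2.
  by rewrite e1 exprMn mulrDr mulr1; lra.
have [r0|r0] := leP 0 r.
  by have : r ^+ 2 <= (s - 1) ^+ 2; [nra|have := sqr_ge0 (1 - s^-1); lra].
by have : r ^+ 2 <= (1 - s^-1) ^+ 2; [nra|have := sqr_ge0 (s - 1); lra].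
Qed.

(** The first two summands bound (ln s)^2 and the third bounds 2 ln l (s - 1 - ln s), for s = x / l
    >= c / l; the factor l^-2 turns (s - 1)^2 into (x - l)^2. *)
Definition ln2_bound {R : realType} (c l : R) : R :=
  l^-1 ^+ 2 * (1 + (l / c) ^+ 2 + 2 * `|ln l| * (l / c)).

Lemma ln2_bound_ge0 {R : realType} (c l : R) :
  0 < c -> 0 < l -> 0 <= ln2_bound c l.
Proof.
move=> c0 l0; rewrite mulr_ge0 ?sqr_ge0 //.
rewrite addr_ge0 ?addr_ge0 ?sqr_ge0 ?ler01 //.
by rewrite !mulr_ge0 // ?invr_ge0 ltW.
Qed.

(** With s = x / l, the remainder equals (ln s)^2 - 2 ln l (s - 1 - ln s), and [ln_taylor_le] with
    s0 = c / l bounds both terms. *)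
Lemma ln2_taylor_le {R : realType} (c l x : R) : 0 < c -> c <= x -> 0 < l ->
  `|ln x ^+ 2 - ln l ^+ 2 - 2 * ln l / l * (x - l)|
    <= ln2_bound c l * (x - l) ^+ 2.
Proof.
move=> c0 cx l0; have x0 : 0 < x by exact: lt_le_trans cx.
have ln0 : l != 0 by rewrite gt_eqF.
have xl : c / l <= x / l by rewrite ler_pM2r // invr_gt0.
have [] := @ln_taylor_le R (x / l) (c / l) (divr_gt0 c0 l0) xl.
have -> : ln x = ln (x / l) + ln l by rewrite ln_div ?posrE // subrK.
rewrite invf_div; move: (ln (x / l)) => r.
have -> : x - l = l * (x / l - 1) by rewrite mulrBr mulr1 mulrCA divff // mulr1.
move: (x / l) => s h1 h2.
have -> : 2 * ln l / l * (l * (s - 1)) = 2 * ln l * (s - 1).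
  by rewrite mulrA divfK.
have -> : ln2_bound c l * (l * (s - 1)) ^+ 2 =
  (s - 1) ^+ 2 * (1 + (l / c) ^+ 2) + 2 * `|ln l| * ((s - 1) ^+ 2 * (l / c)).
  by rewrite /ln2_bound exprMn; field; rewrite ln0 gt_eqF.
have -> : (r + ln l) ^+ 2 - ln l ^+ 2 - 2 * ln l * (s - 1) =
   r ^+ 2 - 2 * ln l * (s - 1 - r) by ring.
rewrite (le_trans (ler_normB _ _)) //; apply: lerD.
  by rewrite ger0_norm ?sqr_ge0.
rewrite !normrM (@ger0_norm _ 2) // ler_wpM2l ?mulr_ge0 //.
by case/andP: h1 => h1 h3; rewrite ger0_norm // -[l / c]invf_div.
Qed.

(** Since q vanishes at t together with its differential, it is o(h), so F inherits the first-order
    expansion of l. This reduces differentiability of a spectral function to an inequality. *)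
Lemma is_diff_sandwich {R : realType} {V : normedModType R}
    (F l q : V -> R) (t : V) :
  differentiable l t ->
  differentiable q t -> q t = 0 -> (forall v, 'd q t v = 0) ->
  (\forall s \near t, `|F s - F t - (l s - l t)| <= q s) ->
  is_diff t F ('d l t).
Proof.
move=> dl dq q0 dq0 Fl.
have E : F \o shift t = cst (F t) + 'd l t +o_ 0 id.
  apply/eqaddoP => e e0; have e2 : 0 < e / 2 by rewrite divr_gt0.
  have /eqaddoP/(_ _ e2) hl := diff_locally dl.
  have /eqaddoP/(_ _ e2) hq := diff_locally dq.
  have hF : \forall h \near (0 : V),
      `|F (h + t) - F t - (l (h + t) - l t)| <= q (h + t).
    by move: Fl; rewrite (near_shift 0) subr0.
  apply: filterS3 hF hl hq => h h1.
  (* Unfolds the little-o bounds at h; the errors of l and q each take half of e. *)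
  change (`|l (h + t) - (l t + 'd l t h)| <= e / 2 * `|h| ->
    `|q (h + t) - (q t + 'd q t h)| <= e / 2 * `|h| ->
    `|F (h + t) - (F t + 'd l t h)| <= e * `|h|).
  rewrite (dq0 h) q0 addr0 subr0 => h2 h3.
  have h4 := ler_norm (q (h + t)).
  have -> : F (h + t) - (F t + 'd l t h) = (F (h + t) - F t - (l (h + t) - l t))
      + (l (h + t) - (l t + 'd l t h)) by ring.
  by rewrite (le_trans (ler_normD _ _)) //; lra.
have dF : 'd F t = 'd l t :> (V -> R).
  by apply: diff_unique E; exact: diff_continuous.
split=> //; apply/diff_locallyP; rewrite dF; split=> //.
exact: diff_continuous.
Qed.

(** * Quadratic remainder for the trace of the squared logarithm *)

Section Klein.
Context {R : realType} {n : nat}.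
Implicit Types (A B : 'M[R[i]]_n).

Lemma posdefmx_herm A : posdefmx A -> A^t* = A.
Proof. by case=> /hermsymmxP. Qed.

(** The constants depend on [A] alone: eigenvalues of a nearby [B] stay away from 0, so the scalar
    Taylor bound is uniform over all pairs of eigenvalues. *)
Lemma trace_ln2_taylor A : posdefmx A ->
  exists C delta : R, 0 < delta /\
  forall B, posdefmx B -> frob2 (B - A) < delta ->
  `|frob2 (lnmx B) - frob2 (lnmx A)
    - complex.Re (\tr (hermfun (fun x => 2 * ln x / x) A *m (B - A)))|
    <= C * frob2 (B - A).
Proof.
move=> pA; have hA := posdefmx_herm pA.
(* Eigenvalues of [A] are at least 2c; with delta = c^2, those of [B] will be at least c. The
   default value 1 of the minimum merely caps c. *)
pose c : R := (\big[Num.min/1]_k eigv A k) / 2.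
have c0 : 0 < c.
  by rewrite divr_gt0 //; apply/bigmin_gtP; split=> // k _; exact: eigv_gt0.
have cA k : c *+ 2 <= eigv A k.
  by rewrite -mulr_natr divfK ?pnatr_eq0 // bigmin_le.
exists (\sum_k ln2_bound c (eigv A k)), (c ^+ 2); split.
  by rewrite exprn_gt0.
move=> B pB; have hB := posdefmx_herm pB.
(* Every quantity in the claim becomes [T] of a scalar function of a pair of eigenvalues, so the
   claim can be checked termwise. *)
pose T (F : R -> R -> R) :=
  \sum_i \sum_j overlap A B i j * F (eigv A i) (eigv B j).
have TD F G : T F + T G = T (fun x y => F x y + G x y).
  rewrite /T -big_split; apply: eq_bigr => i _; rewrite -big_split.
  by apply: eq_bigr => j _; rewrite mulrDr.
have TN F : - T F = T (fun x y => - F x y).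
  rewrite /T -sumrN; apply: eq_bigr => i _; rewrite -sumrN.
  by apply: eq_bigr => j _; rewrite mulrN.
have eqT F G : (forall x y, F x y = G x y) -> T F = T G.
  by move=> FG; apply: eq_bigr => i _; apply: eq_bigr => j _; rewrite FG.
have trT f g : complex.Re (\tr (hermfun f A *m hermfun g B)) =
    T (fun x y => f x * g y).
  by rewrite trace_hermfunM.
have frob2T f M : frob2 (hermfun f M) =
    complex.Re (\tr (hermfun (fun x => f x * f x) M)).
  by rewrite -hermfunM -frob2_hermitian // hermfun_hermitian.
(* A trace involving one matrix is put in two-matrix form by inserting the identity as the constant
   function 1 of the other. *)
have trA f : complex.Re (\tr (hermfun f A)) = T (fun x _ => f x).
  rewrite -[hermfun f A]mulmx1 -(hermfun1 B) trT.
  by apply: eqT => x y; rewrite mulr1.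
have trB f : complex.Re (\tr (hermfun f B)) = T (fun _ y => f y).
  rewrite -[hermfun f B]mul1mx -(hermfun1 A) trT.
  by apply: eqT => x y; rewrite mul1r.
have trAM f : complex.Re (\tr (hermfun f A *m (B - A))) =
    T (fun x y => f x * (y - x)).
  rewrite -{1}(hermfun_id hB) -{2}(hermfun_id hA) mulmxBr hermfunM.
  by rewrite linearB raddfB /= trT trA TN TD; apply: eqT => x y; rewrite mulrBr.
(* The trace of (B - A)^2 is split as tr (B (B - A)) - tr (A (B - A)). *)
have -> : frob2 (B - A) = T (fun x y => (y - x) ^+ 2).
  have hBA : (B - A)^t* = B - A by rewrite !linearB /= map_mxB hA hB.
  have := congr1 (@complex.Re R) (frob2_hermitian hBA); rewrite /= => ->.
  rewrite mulmxBl linearB raddfB /=.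
  have -> : complex.Re (\tr (B *m (B - A))) = T (fun x y => y * (y - x)).
    rewrite mulmxBr -{1 2}(hermfun_id hB) hermfunM linearB raddfB /= trB.
    rewrite mxtrace_mulC -{1}(hermfun_id hA) -{1}(hermfun_id hB) trT TN TD.
    by apply: eqT => x y; ring.
  rewrite -{1}(hermfun_id hA) trAM TN TD; apply: eqT => x y; ring.
move=> small.
(* The weights of column j add up to 1, so some a_i is within |B - A|_F of
   b_j. *)
have cB j : c <= eigv B j.
  rewrite leNgt; apply/negP => ltc; move: small; rewrite ltNge => /negP; apply.
  rewrite -[leLHS]mul1r -(sum_overlap A B j) mulr_suml /T.
  apply: ler_sum => i _; rewrite (bigD1 j) //= -[leLHS]addr0; apply: lerD.
    rewrite ler_wpM2l ?overlap_ge0 //; have := cA i; nra.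
  by apply: sumr_ge0 => k _; rewrite mulr_ge0 ?overlap_ge0 ?sqr_ge0.
rewrite /lnmx !frob2T trAM trA trB !TN !TD /T mulr_sumr.
rewrite (le_trans (ler_norm_sum _ _ _)) //; apply: ler_sum => i _.
rewrite mulr_sumr (le_trans (ler_norm_sum _ _ _)) //; apply: ler_sum => j _.
rewrite normrM ger0_norm ?overlap_ge0 // mulrCA ler_wpM2l ?overlap_ge0 //.
have := ln2_taylor_le c0 (cB j) (eigv_gt0 i pA).
rewrite !expr2 => /le_trans; apply.
(* The constant of the i-th eigenvalue is dominated by the sum of all of them, as they are
   nonnegative. *)
rewrite -expr2 ler_wpM2r ?sqr_ge0 // (bigD1 i) //= lerDl.
by apply: sumr_ge0 => k _; apply: ln2_bound_ge0 => //; exact: eigv_gt0.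
Qed.

End Klein.

(** * Differentiation of matrix-valued maps *)

Lemma is_diff_sum {R : realType} {V : normedModType R} k
    (f df : 'I_k -> V -> R) t :
  (forall i, is_diff t (f i) (df i)) ->
  is_diff t (fun s => \sum_i f i s) (fun v => \sum_i df i v).
Proof.
have sumE (g : 'I_k -> V -> R) : (fun s => \sum_i g i s) = \sum_i g i.
  by apply/funext => s; rewrite fct_sumE.
move=> h; rewrite !sumE; elim/big_ind2 : _ => [|f1 df1 f2 df2 h1 h2|i _].
- exact: is_diff_cst.
- exact: is_diffD.
- exact: h.
Qed.

Section MatrixPaths.
Context {R : realType} {V : normedModType R} {n : nat}.
Implicit Types (M : V -> 'M[R[i]]_n) (A G S : 'M[R[i]]_n).

(** Real differentiability is meant, hence the separate real and imaginary parts. *)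
Definition mxdiff M t : Prop := forall a b,
  differentiable (fun s => complex.Re (M s a b)) t /\
  differentiable (fun s => complex.Im (M s a b)) t.

Definition dmx M t v : 'M[R[i]]_n := \matrix_(a, b)
  ('d (fun s => complex.Re (M s a b)) t v
   +i* 'd (fun s => complex.Im (M s a b)) t v).

Lemma Re_trmul G A : complex.Re (\tr (G *m A)) = \sum_a \sum_b
  (complex.Re (G a b) * complex.Re (A b a)
   - complex.Im (G a b) * complex.Im (A b a)).
Proof.
rewrite /mxtrace raddf_sum; apply: eq_bigr => a _.
rewrite mxE raddf_sum; apply: eq_bigr => b _ /=.
by case: (G a b) (A b a) => ? ? [].
Qed.

(** Every real-linear functional of a complex matrix has the form Re tr (G X), so this one rule also
    covers the entries of a congruence. *)
Lemma is_diff_trmul M t G : mxdiff M t ->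
  is_diff t (fun s => complex.Re (\tr (G *m M s)))
            (fun v => complex.Re (\tr (G *m dmx M t v))).
Proof.
move=> dM.
have -> : (fun s => complex.Re (\tr (G *m M s))) = fun s => \sum_a \sum_b
  (complex.Re (G a b) * complex.Re (M s b a)
   - complex.Im (G a b) * complex.Im (M s b a)).
  by apply/funext => s; rewrite Re_trmul.
have -> : (fun v => complex.Re (\tr (G *m dmx M t v))) = fun v => \sum_a \sum_b
  (complex.Re (G a b) * 'd (fun s => complex.Re (M s b a)) t v
   - complex.Im (G a b) * 'd (fun s => complex.Im (M s b a)) t v).
  apply/funext => v; rewrite Re_trmul; apply: eq_bigr => a _.
  by apply: eq_bigr => b _; rewrite mxE.
apply: is_diff_sum => a; apply: is_diff_sum => b.
have [/differentiableP d1 /differentiableP d2] := dM b a.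
exact: is_diffB (is_diffZ _ d1) (is_diffZ _ d2).
Qed.

Lemma trace_delta_mul A a b : \tr (delta_mx b a *m A) = A a b.
Proof.
rewrite /mxtrace (bigD1 b) //= big1 ?addr0 => [|k kb].
  rewrite mxE (bigD1 a) //= big1 ?addr0 => [|l la].
    by rewrite mxE !eqxx mul1r.
  by rewrite mxE (negPf la) andbF mul0r.
by rewrite mxE big1 // => l _; rewrite mxE (negPf kb) mul0r.
Qed.

(** The scalar k selects a part of the entry: the real part of the product is the real part of the
    entry for k = 1 and its imaginary part for k = -i. *)
Lemma congr_entry S A a b k :
  (S *m A *m S) a b * k = \tr (k *: (S *m delta_mx b a *m S) *m A).
Proof.
rewrite -scalemxAl linearZ /= mulrC; congr (_ * _).
rewrite -!mulmxA mxtrace_mulC -!mulmxA mulmxA trace_delta_mul.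
by rewrite -mulmxA !mulmxA.
Qed.

Lemma is_diff_congr_Re M t S a b : mxdiff M t ->
  is_diff t (fun s => complex.Re ((S *m M s *m S) a b))
            (fun v => complex.Re ((S *m dmx M t v *m S) a b)).
Proof.
move=> dM; have E X : complex.Re ((S *m X *m S) a b) =
    complex.Re (\tr (1 *: (S *m delta_mx b a *m S) *m X)).
  by rewrite -congr_entry mulr1.
under eq_fun do rewrite E; under [X in is_diff _ _ X]eq_fun do rewrite E.
exact: is_diff_trmul.
Qed.

Lemma is_diff_congr_Im M t S a b : mxdiff M t ->
  is_diff t (fun s => complex.Im ((S *m M s *m S) a b))
            (fun v => complex.Im ((S *m dmx M t v *m S) a b)).
Proof.
move=> dM; have E X : complex.Im ((S *m X *m S) a b) =
    complex.Re (\tr ((0 -i* 1) *: (S *m delta_mx b a *m S) *m X)).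
  rewrite -congr_entry; case: ((S *m X *m S) a b) => x y /=.
  by rewrite mulr0 mulrN mulr1 add0r opprK.
under eq_fun do rewrite E; under [X in is_diff _ _ X]eq_fun do rewrite E.
exact: is_diff_trmul.
Qed.

Lemma mxdiff_congr M t S : mxdiff M t -> mxdiff (fun s => S *m M s *m S) t.
Proof.
move=> dM a b.
have dr := is_diff_congr_Re S a b dM; have di := is_diff_congr_Im S a b dM.
split; first by apply: (@ex_diff _ _ _ _ _ _ _ dr).
by apply: (@ex_diff _ _ _ _ _ _ _ di).
Qed.

Lemma dmx_congr M t S v : mxdiff M t ->
  dmx (fun s => S *m M s *m S) t v = S *m dmx M t v *m S.
Proof.
move=> dM; apply/matrixP => a b; rewrite mxE.
rewrite (@diff_val _ _ _ _ _ _ _ (is_diff_congr_Re S a b dM)).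
rewrite (@diff_val _ _ _ _ _ _ _ (is_diff_congr_Im S a b dM)).
by case: ((_ *m S) a b).
Qed.

Lemma frob2_0 : frob2 (0 : 'M[R[i]]_n) = 0.
Proof.
rewrite /frob2 big1 // => a _; rewrite big1 // => b _.
by rewrite mxE /= expr0n addr0.
Qed.

(** Each summand is the square of a function vanishing at t. This provides the function q for
    [is_diff_sandwich]. *)
Lemma is_diff_frob2 M t : mxdiff M t ->
  is_diff t (fun s => frob2 (M s - M t)) (cst 0).
Proof.
move=> dM.
have sqr0 (f : V -> R) : differentiable f t ->
    is_diff t (fun s => (f s - f t) ^+ 2) (cst 0).
  move=> /differentiableP df; have dg := is_diffB df (is_diff_cst (f t) t).
  apply: is_diff_eq (is_diffM dg dg) _.
  by apply/funext => v; rewrite !fctE /= subrr !scale0r addr0.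
have -> : (fun s => frob2 (M s - M t)) = fun s => \sum_a \sum_b
    (((fun s => (complex.Re (M s a b) - complex.Re (M t a b)) ^+ 2) +
    (fun s => (complex.Im (M s a b) - complex.Im (M t a b)) ^+ 2)) s).
  apply/funext => s; apply: eq_bigr => a _; apply: eq_bigr => b _.
  by rewrite !mxE !raddfB.
have -> : cst 0 =
    fun v : V => \sum_(a < n) \sum_(b < n) (cst 0 + cst 0 : V -> R) v.
  apply/funext => v; rewrite big1 // => a _; rewrite big1 // => b _.
  exact: addr0.
apply: is_diff_sum => a; apply: is_diff_sum => b; have [d1 d2] := dM a b.
by apply: is_diffD; exact: sqr0.
Qed.

Lemma is_diff_frob2_lnmx M t :
  mxdiff M t -> (\forall s \near t, posdefmx (M s)) ->
  is_diff t (fun s => frob2 (lnmx (M s))) (fun v => complex.Re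
    (\tr (hermfun (fun x => 2 * ln x / x) (M t) *m dmx M t v))).
Proof.
move=> dM pM.
have [C [delta [delta0 HC]]] := trace_ln2_taylor (nbhs_singleton pM).
set G := hermfun _ (M t) in HC *.
have dl := is_diff_trmul G dM; have dq := is_diff_frob2 dM.
rewrite -(@diff_val _ _ _ _ _ _ _ dl).
apply: (@is_diff_sandwich _ _ _ _ (fun s => C * frob2 (M s - M t))).
- exact: (@ex_diff _ _ _ _ _ _ _ dl).
- apply: (@ex_diff _ _ _ _ _ _ _ (is_diffZ C dq)).
- by rewrite subrr frob2_0 mulr0.
- by move=> v; rewrite (@diff_val _ _ _ _ _ _ _ (is_diffZ C dq)); exact: mulr0.
(* The Taylor bound holds only within delta of [M t]; continuity brings [M s] into that range. *)
have cq : \forall s \near t, frob2 (M s - M t) < delta.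
  have := @differentiable_continuous _ _ _ _ _ (@ex_diff _ _ _ _ _ _ _ dq).
  move=> /(_ _ (@nbhsx_ballx _ _ _ _ delta0)); rewrite subrr.
  move=> nb; have {}nb : \forall s \near t, ball (frob2 (0 : 'M[R[i]]_n)) delta
    (frob2 (M s - M t)) := nb.
  apply: filterS nb => s; rewrite /ball /= frob2_0 sub0r normrN.
  exact: le_lt_trans (ler_norm _).
near=> s; have := HC (M s).
rewrite mulmxBr !linearB /= => H; apply: H; near: s; [exact: pM|exact: cq].
Unshelve. all: by end_near. Qed.

End MatrixPaths.

(** * Square roots, congruences and the Riemannian metric *)

Section Metric.
Context {R : realType} {n : nat}.
Implicit Types (A B X Y S : 'M[R[i]]_n).

Lemma hermfunZ (k : R) (f : R -> R) A :
  hermfun (fun x => k * f x) A = k%:C *: hermfun f A.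
Proof.
rewrite !hermfunE scalemxAl scalemxAr; congr (_ *m _ *m _).
rewrite -linearZ /=; congr diag_mx; apply/rowP => i; rewrite !mxE.
exact: rmorphM.
Qed.

Lemma posdefmx_unit A : posdefmx A -> A \in unitmx.
Proof.
move=> pA; rewrite -(hermfun_id (posdefmx_herm pA)).
by have [] := @hermfun_unit _ _ id A (fun k => lt0r_neq0 (eigv_gt0 k pA)).
Qed.

Lemma invmx_posdef A : posdefmx A -> invmx A = hermfun GRing.inv A.
Proof.
move=> pA; rewrite -{1}(hermfun_id (posdefmx_herm pA)).
by have [] := @hermfun_unit _ _ id A (fun k => lt0r_neq0 (eigv_gt0 k pA)).
Qed.

Lemma invsqrtmxK A : posdefmx A -> invsqrtmx A *m sqrtmx A = 1%:M.
Proof.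
move=> pA; rewrite hermfunM -(hermfun1 A); apply: eq_hermfun => k.
by rewrite mulVf // gt_eqF // sqrtr_gt0 eigv_gt0.
Qed.

Lemma invsqrtmx_unit A : posdefmx A -> invsqrtmx A \in unitmx.
Proof. by move=> /invsqrtmxK/mulmx1_unit/proj1. Qed.

Lemma invsqrtmx_sqr A : posdefmx A -> invsqrtmx A *m invsqrtmx A = invmx A.
Proof.
move=> pA; rewrite invmx_posdef // hermfunM; apply: eq_hermfun => k.
by rewrite -invfM -expr2 sqr_sqrtr // ltW // eigv_gt0.
Qed.

Lemma posdefmx_invsqrt A B : posdefmx A -> posdefmx B ->
  posdefmx (invsqrtmx A *m B *m invsqrtmx A).
Proof.
move=> pA pB; apply: posdefmx_congr => //; first exact: hermfun_hermitian.
exact: invsqrtmx_unit.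
Qed.

Lemma invmx_congr S Q B : S *m Q = 1%:M -> B \in unitmx ->
  invmx (S *m B *m S) = Q *m invmx B *m Q.
Proof.
move=> SQ uB; have CQ : (S *m B *m S) *m (Q *m invmx B *m Q) = 1%:M.
  rewrite !mulmxA -[X in X *m _ *m _ = _]mulmxA SQ mulmx1.
  by rewrite -[X in X *m _ = _]mulmxA mulmxV // mulmx1.
have [uC _] := mulmx1_unit CQ.
by rewrite -[RHS]mul1mx -(mulVmx uC) -[RHS]mulmxA CQ mulmx1.
Qed.

Lemma hermfun_dln2 A : posdefmx A ->
  hermfun (fun x => 2 * ln x / x) A = 2 *: (lnmx A *m invmx A).
Proof.
move=> pA; rewrite invmx_posdef // hermfunM.
rewrite -[2 in RHS](rmorph_nat (real_complex R) 2).
by rewrite -hermfunZ; apply: eq_hermfun => k; rewrite mulrA.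
Qed.

(** With C = S B S and Q the inverse of S, C^-1 = Q B^-1 Q. The factor Q S cancels, and cyclicity
    moves the last S to the front. *)
Lemma trace_geodist_grad A B X : posdefmx A -> posdefmx B ->
  let S := invsqrtmx A in
  \tr (hermfun (fun x => 2 * ln x / x) (S *m B *m S) *m (S *m X *m S)) =
  2 * \tr (S *m lnmx (S *m B *m S) *m sqrtmx A *m invmx B *m X).
Proof.
move=> pA pB /=; have SQ := invsqrtmxK pA; have pC := posdefmx_invsqrt pA pB.
rewrite (hermfun_dln2 pC) (invmx_congr SQ (posdefmx_unit pB)).
move: (invsqrtmx A) (sqrtmx A) (lnmx _) SQ => S Q L SQ.
have QS : Q *m S = 1%:M := mulmx1C SQ.
rewrite -scalemxAl linearZ /=; congr (_ * _).
rewrite mulmxA mxtrace_mulC !mulmxA; congr (\tr (_ *m _)).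
by rewrite -[LHS]mulmxA QS mulmx1.
Qed.

Lemma riem_metricC A X Y : riem_metric A X Y = riem_metric A Y X.
Proof. by rewrite /riem_metric -!mulmxA mulmxA mxtrace_mulC !mulmxA. Qed.

Lemma herm_congr S X : S^t* = S -> X^t* = X -> (S *m X *m S)^t* = S *m X *m S.
Proof. by move=> hS hX; rewrite !trmx_mul !map_mxM hX hS mulmxA. Qed.

Lemma riem_metric_eq0 A X :
  posdefmx A -> X^t* = X -> riem_metric A X X = 0 -> X = 0.
Proof.
move=> pA hX; rewrite /riem_metric -(invsqrtmx_sqr pA).
have : (invsqrtmx A)^t* = invsqrtmx A by exact: hermfun_hermitian.
move: (invsqrtmx A) (invsqrtmx_unit pA) => S Su hS.
have hY := herm_congr hS hX.
have -> : \tr (S *m S *m X *m (S *m S) *m X) =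
    \tr ((S *m X *m S) *m (S *m X *m S)).
  by rewrite [X in _ = \tr X]mulmxA [RHS]mxtrace_mulC !mulmxA.
rewrite -(frob2_hermitian hY) /= => /frob2_eq0 Y0.
have : invmx S *m (S *m X *m S) *m invmx S = 0 by rewrite Y0 mulmx0 mul0mx.
by rewrite mulmxA mulmxK // mulKmx.
Qed.

(** Real coefficients pass through the real part in [riem_metric]; this gives bilinearity in
    coordinates. *)
Lemma riem_metric_suml A k (c : 'I_k -> R) (X : 'I_k -> 'M[R[i]]_n) Y :
  riem_metric A (\sum_j (c j)%:C *: X j) Y = \sum_j c j * riem_metric A (X j) Y.
Proof.
rewrite /riem_metric mulmx_sumr !mulmx_suml.
rewrite (raddf_sum (@mxtrace _ n)) raddf_sum.
apply: eq_bigr => j _ /=; rewrite -scalemxAr -!scalemxAl linearZ /=.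
by case: (\tr _) => x y /=; rewrite mul0r subr0.
Qed.

End Metric.

(** * Differential of the squared geodesic distance *)

Section Paths.
Context {R : realType} {V : normedModType R} {n : nat}.
Implicit Types (M : V -> 'M[R[i]]_n) (A : 'M[R[i]]_n).

Lemma is_diff_geodist2 M t A : posdefmx A -> mxdiff M t ->
  (\forall s \near t, posdefmx (M s)) ->
  is_diff t (fun s => geodist A (M s) ^+ 2) (fun v => complex.Re (2 *
    \tr (invsqrtmx A *m lnmx (invsqrtmx A *m M t *m invsqrtmx A) *m sqrtmx A
         *m invmx (M t) *m dmx M t v))).
Proof.
move=> pA dM pM.
have dC := mxdiff_congr (invsqrtmx A) dM.
have := is_diff_frob2_lnmx dC; have pMt := nbhs_singleton pM.
have -> : (fun s => geodist A (M s) ^+ 2) =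
    fun s => frob2 (lnmx (invsqrtmx A *m M s *m invsqrtmx A)).
  by apply/funext => s; rewrite -sqr_frobenius.
under [X in _ -> is_diff _ _ X]eq_fun => v.
  rewrite -trace_geodist_grad // -dmx_congr //; over.
by apply; apply: filterS pM => s; exact: posdefmx_invsqrt.
Qed.

End Paths.

(** * Gradients and the metric matrix in coordinates *)

Section Chart.
Context {R : realType} {m n : nat}.
Implicit Types (t v w : 'cV[R]_m).
Implicit Types (P : 'cV[R]_m -> 'M[R[i]]_n) (L : 'cV[R]_m -> R).

Lemma dirmx_dmx P t v : mxdiff P t -> dirmx P t v = dmx P t v.
Proof.
move=> dP; apply/matrixP => a b; have [d1 d2] := dP a b.
by rewrite !mxE !deriveE.
Qed.

Lemma cV_sum_delta v : v = \sum_j v j 0 *: delta_mx j 0.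
Proof.
rewrite {1}(matrix_sum_delta v); apply: eq_bigr => j _.
by rewrite big_ord1.
Qed.

Lemma diff_partials L t v : differentiable L t ->
  'd L t v = \sum_j v j 0 * nabla L t j 0.
Proof.
move=> dL; rewrite {1}(cV_sum_delta v) linear_sum; apply: eq_bigr => j _.
by rewrite linearZ mxE deriveE.
Qed.

Lemma dirmx_partials P t v : mxdiff P t ->
  dirmx P t v = \sum_j (v j 0)%:C *: partialmx P j t.
Proof.
move=> dP; apply/matrixP => a b; have [d1 d2] := dP a b.
rewrite summxE mxE !deriveE // !diff_partials //.
apply/eqP; rewrite eq_complex !raddf_sum /=; apply/andP; split; apply/eqP.
  by apply: eq_bigr => j _; rewrite !mxE /= mul0r subr0.
by apply: eq_bigr => j _; rewrite !mxE /= mul0r addr0.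
Qed.

Lemma riem_metric_dirmx P t v w : mxdiff P t ->
  riem_metric (P t) (dirmx P t v) (dirmx P t w) =
  (v^T *m metric_matrix P t *m w) 0 0.
Proof.
move=> dP; rewrite (dirmx_partials v dP) riem_metric_suml -mulmxA mxE.
apply: eq_bigr => i _; rewrite !mxE riem_metricC.
rewrite (dirmx_partials w dP) riem_metric_suml; congr (_ * _).
by apply: eq_bigr => j _; rewrite mxE mulrC riem_metricC.
Qed.

Lemma metric_matrix_sym P t : (metric_matrix P t)^T = metric_matrix P t.
Proof. by apply/matrixP => i j; rewrite !mxE riem_metricC. Qed.

(** The identity between entry (a, b) and the conjugate of entry (b, a) holds near t, so it can be
    differentiated; conjugation is real-linear. *)
Lemma dirmx_herm P t v : mxdiff P t -> (\forall s \near t, (P s)^t* = P s) ->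
  (dirmx P t v)^t* = dirmx P t v.
Proof.
move=> dP hP; have conjE (x y : R) : (x +i* y)^* = x -i* y :> R[i] by [].
have hPab a b : \forall s \near t, P s a b = (P s b a)^*.
  by apply: filterS hP => s hs; rewrite -{1}hs !mxE.
apply/matrixP => a b; rewrite !mxE /= conjE; congr (_ +i* _).
  by apply: near_eq_derive; apply: filterS (hPab a b) => s ->; case: (P s b a).
rewrite -deriveN; last by have [_ d] := dP b a; exact: diff_derivable.
apply: near_eq_derive; apply: filterS (hPab a b) => s ->.
by rewrite opprfctE; case: (P s b a).
Qed.

Lemma is_riem_gradE P L t v : mxdiff P t -> differentiable L t ->
  metric_matrix P t \in unitmx ->
  is_riem_grad P L t v <-> v = invmx (metric_matrix P t) *m nabla L t.
Proof.
move=> dP dL Gu; set G := metric_matrix P t in Gu *.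
have GT : G^T = G := metric_matrix_sym P t.
have vG w : riem_metric (P t) (dirmx P t v) (dirmx P t w) =
    \sum_j w j 0 * (G *m v) j 0.
  rewrite riem_metric_dirmx // -/G -[G in LHS]GT -trmx_mul mxE.
  by apply: eq_bigr => j _; rewrite mxE mulrC.
split=> [[_ gradv]|vE]; last first.
  split=> // w; rewrite diff_partials // vG.
  by rewrite vE mulKVmx.
(* Testing duality on the basis vectors recovers the components one by one. *)
have -> : nabla L t = G *m v; last by rewrite mulKmx.
apply/colP => j; have := gradv (delta_mx j 0); rewrite vG diff_partials //.
have dj (u : 'cV[R]_m) : \sum_k (delta_mx j 0 : 'cV[R]_m) k 0 * u k 0 = u j 0.
  rewrite (bigD1 j) //= big1 ?addr0 => [|k kj].
    by rewrite mxE !eqxx mul1r.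
  by rewrite mxE (negPf kj) mul0r.
by rewrite !dj.
Qed.

(** For u in the left kernel of the metric matrix, the tangent vector along u^T has metric norm 0.
    It vanishes by definiteness, and then so does u by immersivity. *)
Lemma metric_matrix_unit P t :
  mxdiff P t -> (\forall s \near t, posdefmx (P s)) ->
  (forall v, dirmx P t v = 0 -> v = 0) -> metric_matrix P t \in unitmx.
Proof.
move=> dP pP immP; rewrite -row_free_unit -kermx_eq0.
apply/eqP/row_matrixP => k.
rewrite row0; set u := row k _.
have uG : u *m metric_matrix P t = 0 by rewrite -row_mul mulmx_ker row0.
apply: trmx_inj; rewrite trmx0; apply: immP.
apply: (riem_metric_eq0 (nbhs_singleton pP)).
  by apply: dirmx_herm => //; apply: filterS pP => s; exact: posdefmx_herm.
by rewrite riem_metric_dirmx // trmxK uG mul0mx mxE.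
Qed.

Lemma is_diff_cost N (Rs : 'I_N -> 'M[R[i]]_n) P t :
  (forall i, posdefmx (Rs i)) ->
  mxdiff P t -> (\forall s \near t, posdefmx (P s)) ->
  is_diff t (cost Rs P) (fun v => N%:R^-1 * \sum_(i < N) complex.Re (2 *
    \tr (invsqrtmx (Rs i) *m lnmx (invsqrtmx (Rs i) *m P t *m invsqrtmx (Rs i))
         *m sqrtmx (Rs i) *m invmx (P t) *m dmx P t v))).
Proof.
move=> pRs dP pP; apply: (is_diffZ N%:R^-1 (is_diff_sum _)) => i.
exact: is_diff_geodist2.
Qed.

(** The matrix under this trace need not be Hermitian, but its trace equals that of a product of two
    Hermitian matrices. This lifts the real derivative to an equation in [R[i]]. *)
Lemma geodist_grad_real (A B X : 'M[R[i]]_n) :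
  posdefmx A -> posdefmx B -> X^t* = X ->
  let z := 2 * \tr (invsqrtmx A *m lnmx (invsqrtmx A *m B *m invsqrtmx A)
                    *m sqrtmx A *m invmx B *m X) in
  (complex.Re z)%:C = z.
Proof.
move=> pA pB hX; rewrite /= -trace_geodist_grad //.
apply: trace_herm_real; first exact: hermfun_hermitian.
by apply: herm_congr => //; exact: hermfun_hermitian.
Qed.

End Chart.

(** * The natural gradient iteration and its partial derivatives *)

Theorem theorem4p1 (R : realType) (n m N : nat) (n_gt0 : (0 < n)%N)
    (N_gt0 : (0 < N)%N) (Rs : 'I_N -> 'M[R[i]]_n)
    (Rs_sym : forall i, toeplitz_posdef (Rs i))
    (U : set 'cV[R]_m) (P : 'cV[R]_m -> 'M[R[i]]_n) (UP : coordinates U P)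
    (eta : R) :
  (forall t : 'cV[R]_m, U t -> metric_matrix P t \in unitmx) /\
  (forall (theta : nat -> 'cV[R]_m) (k : nat), U (theta k) ->
     (natural_gradient_step P (cost Rs P) eta (theta k) (theta k.+1) <->
      theta k.+1 = theta k
        - eta *: (invmx (metric_matrix P (theta k))
                  *m nabla (cost Rs P) (theta k)))) /\
  (forall (t : 'cV[R]_m) (j : 'I_m), U t ->
     derivable (cost Rs P) t (delta_mx j 0) /\
     (nabla (cost Rs P) t j 0)%:C =
       2 / N%:R * \tr (\sum_(i < N)
          invsqrtmx (Rs i)
          *m lnmx (invsqrtmx (Rs i) *m P t *m invsqrtmx (Rs i))
          *m sqrtmx (Rs i) *m invmx (P t) *m partialmx P j t)).
Proof.
have pRs i : posdefmx (Rs i) by have [] := Rs_sym i.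
have pP t : U t -> \forall s \near t, posdefmx (P s).
  move=> Ut; apply: filterS (open_nbhs_nbhs (conj (coord_open UP) Ut)) => s Us.
  by have [] := coord_mem UP Us.
have dP t : U t -> mxdiff P t.
  move=> Ut a b; have [re im] := coord_smooth UP a b.
  by have [+ _] := re 1; have [+ _] := im 1 => /(_ t Ut) dim /(_ t Ut) dre.
have dL t : U t -> differentiable (cost Rs P) t.
  move=> Ut; have d := is_diff_cost pRs (dP t Ut) (pP t Ut).
  exact: (@ex_diff _ _ _ _ _ _ _ d).
have Gu t : U t -> metric_matrix P t \in unitmx.
  move=> Ut; apply: metric_matrix_unit (dP t Ut) (pP t Ut) _ => v.
  exact: (coord_immersion UP).
split; first exact: Gu.
split=> [theta k Uk|t j Ut].
  (* The Riemannian gradient is the unique such v, so the existential in the iteration step has a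
     single witness. *)
  have gradE v :=
    @is_riem_gradE _ _ _ _ _ _ v (dP _ Uk) (dL _ Uk) (Gu _ Uk).
  split=> [[v /gradE -> //]|step].
  by eexists; [exact/gradE|exact: step].
split; first exact: diff_derivable (dL t Ut).
have d := is_diff_cost pRs (dP t Ut) (pP t Ut).
rewrite mxE deriveE ?dL // (@diff_val _ _ _ _ _ _ _ d) -(dirmx_dmx _ (dP t Ut)).
rewrite -/(partialmx P j t).
have hX : (partialmx P j t)^t* = partialmx P j t.
  apply: dirmx_herm (dP t Ut) _.
  by apply: filterS (pP t Ut) => s; exact: posdefmx_herm.
rewrite rmorphM rmorph_sum fmorphV rmorph_nat.
have pPt := nbhs_singleton (pP t Ut).
rewrite (eq_bigr _ (fun i _ => geodist_grad_real (pRs i) pPt hX)).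
by rewrite (raddf_sum (@mxtrace _ n)) -mulr_sumr mulrA [_ * 2]mulrC.
Qed.
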